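(* Let $\mathbf{k}$ be a field, let $X$ be a finite set of order $n\ge 2$, and let $f,g\in\mathrm{Sym}(X)$. Then the Yang-Baxter algebras of the permutation idempotent solutions $(X,r_f)$ and $(X,r_g)$ are isomorphic: $\mathcal{A}(\mathbf{k},X,r_f)\cong\mathcal{A}(\mathbf{k},X,r_g)$. Moreover, for a fixed enumeration $X=\{x_1,\dots,x_n\}$ these algebras share the same standard finite presentation $$\mathbf{k}\langle X\rangle/(\Re),\qquad \Re=\{x_jx_p-x_1x_p\mid 2\le j\le n,\ 1\le p\le n\},$$ and the same $\mathbf{k}$-basis of normal words $\mathcal{N}=\{1\}\cup\{x_1^{\alpha}x_m\mid\alpha\in\mathbb{N}_0,\ 1\le m\le n\}$.
   Context: For $f\in\mathrm{Sym}(X)$ the permutation idempotent solution is $(X,r_f)$ with $r_f:X\times X\to X\times X$, $r_f(x,y)=(f(y),y)$. Its Yang-Baxter algebra is $\mathcal{A}(\mathbf{k},X,r_f)=\mathbf{k}\langle X\rangle/(xy-f(y)y\mid x,y\in X)$, where $\mathbf{k}\langle X\rangle$ is the free unital associative algebra on $X$. Normal words are taken with respect to the degree-lexicographic order with $x_1<\dots<x_n$: a word is normal modulo an ideal $I$ if it contains no leading monomial of a nonzero element of $I$ as a subword. *)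

(* Defs.v *)
From HB Require Import structures.
From mathcomp Require Import all_boot all_order perm all_algebra finmap.
From mathcomp Require Import boolp classical_sets cardinality.
From mathcomp Require Import monalg.

Set Implicit Arguments.
Unset Strict Implicit.
Unset Printing Implicit Defensive.

Import GRing.Theory.
Local Open Scope classical_set_scope.
Local Open Scope ring_scope.
Local Open Scope quotient_scope.

HB.mixin Record isRightStable (R : nzRingType) (S : R -> bool) := {
  right_stable_subproof : forall a : R, {in S, forall u, u * a \in S}
}.

(* [idealr] requires a proper additive subgroup, stable under multiplication
   on the left. *)
#[short(type="twoSidedIdeal")]
HB.structure Definition TwoSidedIdeal (R : nzRingType) :=
  {S of Idealr R S & isRightStable R S}.

(* [{quot I}] has a ring structure in the library only over a commutative
   ring, hence the alias. *)
Definition alg_quot (k : fieldType) (A : algType k) (I : twoSidedIdeal A) :=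
  Quotient.quot I.

Section AlgQuot.
Variables (k : fieldType) (A : algType k) (I : twoSidedIdeal A).
Local Notation Q := (alg_quot I).

HB.instance Definition _ := Choice.on Q.
HB.instance Definition _ : EqQuotient A (Quotient.equiv I) Q := EqQuotient.on Q.
HB.instance Definition _ := GRing.Zmodule.on Q.
HB.instance Definition _ := @isZmodQuotient.Build A (Quotient.equiv I)
  0 -%R +%R Q (lock _) (@Quotient.pi_opp A I) (@Quotient.pi_add A I).

Lemma alg_quotP (x y : A) : (\pi_Q x == \pi_Q y) = (x - y \in (I : A -> bool)).
Proof. by rewrite piE Quotient.equivE. Qed.

Lemma alg_quot_repr (x : A) : x - repr (\pi_Q x) \in (I : A -> bool).
Proof. by rewrite -alg_quotP reprK. Qed.

Lemma alg_quot_right_stable (u a : A) :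
  u \in (I : A -> bool) -> u * a \in (I : A -> bool).
Proof. exact: right_stable_subproof. Qed.

Definition alg_quot_one : Q := \pi_Q 1.
Definition alg_quot_mul := lift_op2 Q *%R.
Definition alg_quot_scale (a : k) := lift_op1 Q ( *:%R a).

Lemma alg_quot_pi_mul (x y : A) :
  alg_quot_mul (\pi_Q x) (\pi_Q y) = \pi_Q (x * y).
Proof.
rewrite /alg_quot_mul; unlock.
apply/esym/eqP; rewrite alg_quotP.
have -> : x * y - repr (\pi_Q x) * repr (\pi_Q y) =
    (x - repr (\pi_Q x)) * y + repr (\pi_Q x) * (y - repr (\pi_Q y)).
  by rewrite mulrBl mulrBr addrA subrK.
rewrite rpredD //; first exact: alg_quot_right_stable (alg_quot_repr x).
exact: idealMr (alg_quot_repr y).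
Qed.

Lemma alg_quot_pi_scale (a : k) (x : A) :
  alg_quot_scale a (\pi_Q x) = \pi_Q (a *: x).
Proof.
rewrite /alg_quot_scale; unlock.
apply/esym/eqP; rewrite alg_quotP -scalerBr -[x - _]mul1r scalerAl.
by rewrite idealMr ?alg_quot_repr.
Qed.

Lemma alg_quot_piD (x y : A) : \pi_Q x + \pi_Q y = \pi_Q (x + y).
Proof. by rewrite !piE. Qed.

Lemma alg_quot_mulA : associative alg_quot_mul.
Proof.
move=> x y z; elim/quotW: x => x; elim/quotW: y => y; elim/quotW: z => z.
by rewrite !alg_quot_pi_mul mulrA.
Qed.

Lemma alg_quot_mul1 : left_id alg_quot_one alg_quot_mul.
Proof. by elim/quotW=> x; rewrite alg_quot_pi_mul mul1r. Qed.

Lemma alg_quot_mulr1 : right_id alg_quot_one alg_quot_mul.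
Proof. by elim/quotW=> x; rewrite alg_quot_pi_mul mulr1. Qed.

Lemma alg_quot_mulDl : left_distributive alg_quot_mul +%R.
Proof.
move=> x y z; elim/quotW: x => x; elim/quotW: y => y; elim/quotW: z => z.
by rewrite !(alg_quot_piD, alg_quot_pi_mul) mulrDl.
Qed.

Lemma alg_quot_mulDr : right_distributive alg_quot_mul +%R.
Proof.
move=> x y z; elim/quotW: x => x; elim/quotW: y => y; elim/quotW: z => z.
by rewrite !(alg_quot_piD, alg_quot_pi_mul) mulrDr.
Qed.

Lemma alg_quot_one_neq0 : alg_quot_one != 0.
Proof.
have -> : 0 = \pi_Q 0 by rewrite piE.
by rewrite alg_quotP subr0 idealr1.
Qed.

HB.instance Definition _ := GRing.Zmodule_isNzRing.Build Q alg_quot_mulA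
  alg_quot_mul1 alg_quot_mulr1 alg_quot_mulDl alg_quot_mulDr alg_quot_one_neq0.

Lemma alg_quot_mulE (x y : A) : \pi_Q x * \pi_Q y = \pi_Q (x * y).
Proof. exact: alg_quot_pi_mul. Qed.

HB.instance Definition _ := @isNzRingQuotient.Build A (Quotient.equiv I)
  0 -%R +%R 1 *%R Q erefl (fun x y => esym (alg_quot_mulE x y)).

Lemma alg_quot_scaleA (a b : k) (u : Q) :
  alg_quot_scale a (alg_quot_scale b u) = alg_quot_scale (a * b) u.
Proof. by elim/quotW: u => u; rewrite !alg_quot_pi_scale scalerA. Qed.

Lemma alg_quot_scale1 : left_id 1 alg_quot_scale.
Proof. by elim/quotW=> u; rewrite alg_quot_pi_scale scale1r. Qed.

Lemma alg_quot_scaleDr : right_distributive alg_quot_scale +%R.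
Proof.
move=> a u v; elim/quotW: u => u; elim/quotW: v => v.
by rewrite !(alg_quot_piD, alg_quot_pi_scale) scalerDr.
Qed.

Lemma alg_quot_scaleDl (u : Q) :
  {morph alg_quot_scale^~ u : a b / a + b >-> a + b}.
Proof.
move=> a b /=; elim/quotW: u => u.
by rewrite !alg_quot_pi_scale alg_quot_piD scalerDl.
Qed.

HB.instance Definition _ := GRing.Zmodule_isLmodule.Build k Q alg_quot_scaleA
  alg_quot_scale1 alg_quot_scaleDr alg_quot_scaleDl.

Lemma alg_quot_scaleE (a : k) (x : A) : a *: \pi_Q x = \pi_Q (a *: x).
Proof. exact: alg_quot_pi_scale. Qed.

Lemma alg_quot_scaleAl (a : k) (u v : Q) : a *: (u * v) = a *: u * v.
Proof.
elim/quotW: u => u; elim/quotW: v => v.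
by rewrite !(alg_quot_scaleE, alg_quot_mulE) scalerAl.
Qed.

HB.instance Definition _ :=
  GRing.Lmodule_isLalgebra.Build k Q alg_quot_scaleAl.

Lemma alg_quot_scaleAr (a : k) (u v : Q) : a *: (u * v) = u * (a *: v).
Proof.
elim/quotW: u => u; elim/quotW: v => v.
by rewrite !(alg_quot_scaleE, alg_quot_mulE) scalerAr.
Qed.

HB.instance Definition _ :=
  GRing.Lalgebra_isAlgebra.Build k Q alg_quot_scaleAr.

End AlgQuot.

Definition alg_isomorphic (k : fieldType) (A B : algType k) : Prop :=
  exists phi : {lrmorphism A -> B}, bijective phi.

(* The monoid algebra of the free monoid [{fmonom X}] of words over X; the
   library makes it an [algType] only for commutative monoids. *)
Definition free_algebra (k : fieldType) (X : choiceType) :=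
  {malg k[{fmonom X}]}.

Section FreeAlgebra.
Variables (k : fieldType) (X : choiceType).

HB.instance Definition _ := GRing.Lalgebra.on (free_algebra k X).

Lemma free_algebra_scaleAr (a : k) (p q : free_algebra k X) :
  a *: (p * q) = p * (a *: q).
Proof.
apply/malgP => w; rewrite mcoeffZ.
rewrite (@mcoeffMlw _ _ (msupp p) (msupp q)) ?fsubset_refl //.
rewrite (@mcoeffMlw _ _ (msupp p) (msupp q)) ?fsubset_refl ?msuppZ_le //.
rewrite mulr_sumr; apply: eq_bigr => u _.
rewrite mulr_sumr; apply: eq_bigr => v _.
by rewrite mcoeffZ mulrnAr mulrCA.
Qed.

HB.instance Definition _ :=
  GRing.Lalgebra_isAlgebra.Build k (free_algebra k X) free_algebra_scaleAr.

Definition word (s : seq X) : free_algebra k X := << FMonom s >>.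

End FreeAlgebra.
Arguments word k {X} s.

Definition ideal_span (R : nzRingType) (S : set R) : set R :=
  [set p | exists2 ts : seq (R * R * R),
     (forall t, t \in ts -> S t.1.2) & p = \sum_(t <- ts) t.1.1 * t.1.2 * t.2].

Section IdealSpan.
Variables (R : nzRingType) (S : set R).

Lemma ideal_span0 : ideal_span S 0.
Proof. by exists [::]; rewrite ?big_nil. Qed.

Lemma ideal_spanMD (a u v : R) :
  ideal_span S u -> ideal_span S v -> ideal_span S (a * u + v).
Proof.
move=> [us usS ->] [vs vsS ->].
exists ([seq (a * t.1.1, t.1.2, t.2) | t <- us] ++ vs).
  by move=> t; rewrite mem_cat => /orP[/mapP[t' /usS ? ->]|/vsS].
rewrite big_cat big_map /= mulr_sumr; congr (_ + _).
by apply: eq_bigr => t _; rewrite !mulrA.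
Qed.

Lemma ideal_spanMr (a u : R) : ideal_span S u -> ideal_span S (u * a).
Proof.
move=> [us usS ->]; exists [seq (t.1.1, t.1.2, t.2 * a) | t <- us].
  by move=> t /mapP[t' /usS ? ->].
by rewrite big_map mulr_suml; apply: eq_bigr => t _; rewrite !mulrA.
Qed.

End IdealSpan.

Section FreeQuotient.
Variables (k : fieldType) (X : choiceType).
Local Notation F := (free_algebra k X).

(* A set of relators without constant term generates a proper ideal, as the
   library's nontrivial ring structure on the quotient requires. *)
Record relators := Relators {
  relators_set :> set F;
  relatorsP : forall p, relators_set p -> p@_mone = 0
}.

Variable S : relators.

Definition relator_ideal : F -> bool := fun p => `[< ideal_span S p >].

Lemma relator_ideal_closed : idealr_closed relator_ideal.
Proof.
split; first exact/asboolP/ideal_span0; last first.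
  move=> a u v /asboolP Iu /asboolP Iv; exact/asboolP/ideal_spanMD.
apply/asboolP => -[ts tsS /(congr1 (mcoeff mone))]; rewrite raddf_sum /=.
rewrite big_seq big1 => [|t /tsS St].
  by rewrite mcoeff1 eqxx => /eqP; rewrite oner_eq0.
by rewrite !rmorphM /= (relatorsP St) mulr0 mul0r.
Qed.

Lemma relator_ideal_right_stable (a : F) :
  {in relator_ideal, forall u, u * a \in relator_ideal}.
Proof. move=> u /asboolP Iu; exact/asboolP/ideal_spanMr. Qed.

HB.instance Definition _ := isIdealr.Build F relator_ideal relator_ideal_closed.
HB.instance Definition _ :=
  isRightStable.Build F relator_ideal relator_ideal_right_stable.

Definition presented_algebra : algType k := alg_quot relator_ideal.

Definition to_presented (p : F) : presented_algebra :=
  \pi_(alg_quot relator_ideal) p.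

End FreeQuotient.

Definition perm_idempotent (X : finType) (f : {perm X}) (u : X * X) : X * X :=
  (f u.2, u.2).

Section YangBaxterAlgebra.
Variables (k : fieldType) (X : choiceType).

Definition yb_relations (r : X * X -> X * X) : set (free_algebra k X) :=
  [set p | exists x y : X,
     p = word k [:: x; y] - word k [:: (r (x, y)).1; (r (x, y)).2]].

Lemma word2B_const (a b c d : X) :
  (word k [:: a; b] - word k [:: c; d])@_mone = 0.
Proof.
have ne1 s e : (FMonom (e :: s) == mone :> {fmonom X}) = false.
  by apply/eqP => E; have := @fm1 X; rewrite -E.
by rewrite mcoeffB !mcoeffU1 !ne1 subrr.
Qed.

Lemma yb_relationsP r p : yb_relations r p -> p@_mone = 0.
Proof. by move=> [x [y ->]]; apply: word2B_const. Qed.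

Definition yb_relators r := Relators (@yb_relationsP r).

Definition yb_algebra r : algType k := presented_algebra (yb_relators r).

End YangBaxterAlgebra.
Arguments yb_relations k {X} r _.
Arguments yb_relators k {X} r.
Arguments yb_algebra k {X} r.

Section WordOrder.
Variable X : choiceType.

Definition enum_lt (n : nat) (x : 'I_n -> X) (a b : X) : Prop :=
  exists i j : 'I_n, [/\ (i < j)%N, x i = a & x j = b].

Definition deglex (lt : X -> X -> Prop) (v w : {fmonom X}) : Prop :=
  (size v < size w)%N \/
  size v = size w /\
  exists (u v' w' : seq X) (a b : X),
    [/\ v = u ++ a :: v' :> seq X, w = u ++ b :: w' :> seq X & lt a b].

End WordOrder.

Section Groebner.
Variables (k : fieldType) (X : choiceType).
Local Notation F := (free_algebra k X).
Variable lt : {fmonom X} -> {fmonom X} -> Prop.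

Definition leading_word (p : F) (w : {fmonom X}) : Prop :=
  w \in msupp p /\ forall v, v \in msupp p -> v = w \/ lt v w.

Definition monic_elt (p : F) : Prop :=
  exists2 w, leading_word p w & p@_w = 1.

Definition normal_words (G : set F) : set {fmonom X} :=
  [set w | forall p v, G p -> p != 0 -> leading_word p v -> ~~ infix v w].

Definition groebner_basis (I G : set F) : Prop :=
  [/\ ideal_span G = I,
      forall g, G g -> monic_elt g
    & forall p v, I p -> p != 0 -> leading_word p v ->
        exists g u, [/\ G g, leading_word g u & infix u v]].

Definition reduced_groebner_basis (I G : set F) : Prop :=
  [/\ groebner_basis I G,
      forall g, G g -> ~ groebner_basis I (G `\ g)
    & forall g w, G g -> w \in msupp g -> normal_words (G `\ g) w].

End Groebner.

(* Two sets of relators S and T define the same algebra: the classes of the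
   generators correspond under an isomorphism. *)
Definition same_presentation (k : fieldType) (X : choiceType)
    (S T : relators k X) : Prop :=
  exists2 phi : {lrmorphism presented_algebra S -> presented_algebra T},
    bijective phi
    & forall x : X, phi (to_presented S (word k [:: x]))
                    = to_presented T (word k [:: x]).

(* "Standard" means that the relators T form a finite reduced Groebner
   basis of the ideal of relations. *)
Definition standard_finite_presentation (k : fieldType) (X : choiceType)
    (lt : {fmonom X} -> {fmonom X} -> Prop) (S T : relators k X) : Prop :=
  [/\ same_presentation S T, finite_set (T : set (free_algebra k X))
    & reduced_groebner_basis lt (ideal_span S) T].

Definition is_basis (k : fieldType) (V : lmodType k) (J : choiceType)
    (N : set J) (e : J -> V) : Prop :=
  (forall (s : seq J) (c : J -> k), uniq s -> {in s, forall j, N j} ->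
     \sum_(j <- s) c j *: e j = 0 -> {in s, forall j, c j = 0}) /\
  (forall v : V, exists (s : seq J) (c : J -> k),
     {in s, forall j, N j} /\ v = \sum_(j <- s) c j *: e j).

Section Corollary.
Variables (k : fieldType) (X : choiceType) (n : nat) (x : 'I_n -> X).
(* Indices are 0-based: [x i] is x_{i+1}, so [0 < j] below reads 2 <= j. *)
Variable n_gt0 : (0 < n)%N.

Let x1 : X := x (Ordinal n_gt0).

Definition frakR_relations : set (free_algebra k X) :=
  [set q | exists j p : 'I_n,
     (0 < j)%N /\ q = word k [:: x j; x p] - word k [:: x1; x p]].

Lemma frakR_relationsP q : frakR_relations q -> q@_mone = 0.
Proof. by move=> [j [p [_ ->]]]; apply: word2B_const. Qed.

Definition frakR : relators k X := Relators frakR_relationsP.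

Definition frakN : set {fmonom X} :=
  [set w | w = FMonom [::] \/
     exists (alpha : nat) (m : 'I_n), w = FMonom (rcons (nseq alpha x1) (x m))].

End Corollary.
Arguments frakR k {X n} x n_gt0.

(* Main.v *)
Require Import Defs.
From HB Require Import structures.
From mathcomp Require Import all_boot all_order perm all_algebra finmap.
From mathcomp Require Import boolp classical_sets cardinality.
From mathcomp Require Import monalg.

(** The relations x y = f(y) y say that x y does not depend on x: for all
    letters a, b, c one has a c = f(c) c = b c.  Conversely the relations
    a c = b c, for all a, b, c, contain those of r_f.  So the ideal of
    relations is the ideal of [first_letter_relations], in which f no longer
    occurs ([yb_idempotent_ideal]); the relators frakR generate it as well
    ([frakR_ideal]).  The isomorphism and the common presentation follow,
    because presentations with the same ideal define the same algebra
    ([same_presentation_eq_ideal]).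

    Modulo that ideal every letter of a word except the last may be replaced
    by x_1; [collapse] does this, giving a word x_1^m c.  Its linear extension
    [normal_form] vanishes exactly on the ideal ([normal_form_ideal]): a
    relation, in any context, relates two words with the same length and the
    same last letter.  Hence the words fixed by [collapse], which are those of
    frakN, form a basis of the quotient ([normal_words_basis]).

    For the Groebner basis, the point is that no word of frakN is the leading
    word v of an element q of the ideal ([leading_normal]).  Indeed no word u
    below v collapses to v ([deglex_collapse]), so the coefficient of v in
    [normal_form q] is its coefficient in q, which is not 0.  A word outside
    frakN has a factor x_j x_p with j > 1, the leading word of the relator
    x_j x_p - x_1 x_p.  Reducedness holds since these leading words are
    pairwise distinct and all of length 2. *)

Set Implicit Arguments.
Unset Strict Implicit.
Unset Printing Implicit Defensive.

Import GRing.Theory.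

(** * Two-sided ideals generated by a set *)

Section IdealSpanTheory.
Local Open Scope classical_set_scope.
Local Open Scope ring_scope.
Variable R : nzRingType.
Implicit Types (S T : set R) (p q : R).

Lemma ideal_spanB S p q :
  ideal_span S p -> ideal_span S q -> ideal_span S (p - q).
Proof.
by move=> Sp Sq; rewrite addrC -mulN1r; apply: ideal_spanMD.
Qed.

Lemma ideal_spanD S p q :
  ideal_span S p -> ideal_span S q -> ideal_span S (p + q).
Proof. by move=> Sp Sq; rewrite -[p]mul1r; apply: ideal_spanMD. Qed.

Lemma ideal_spanMl S p q : ideal_span S q -> ideal_span S (p * q).
Proof.
move=> Sq; rewrite -[p * q]addr0; apply: ideal_spanMD => //.
exact: ideal_span0.
Qed.

Lemma sub_ideal_span S : S `<=` ideal_span S.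
Proof.
move=> p Sp; exists [:: (1, p, 1)]; first by move=> t; rewrite inE => /eqP->.
by rewrite big_seq1 mul1r mulr1.
Qed.

Lemma ideal_span_min S T :
  S `<=` ideal_span T -> ideal_span S `<=` ideal_span T.
Proof.
move=> sST p [ts tsS ->]; rewrite big_seq.
apply: (big_ind (ideal_span T)); first exact: ideal_span0.
  exact: ideal_spanD.
by move=> t /tsS /sST Tt; apply/ideal_spanMr/ideal_spanMl.
Qed.

Lemma eq_ideal_span S T :
  S `<=` ideal_span T -> T `<=` ideal_span S -> ideal_span S = ideal_span T.
Proof. by move=> sST sTS; apply/seteqP; split; apply: ideal_span_min. Qed.

End IdealSpanTheory.

(** * Presentations with the same ideal *)

Section PresentedAlgebra.
Local Open Scope ring_scope.
Local Open Scope quotient_scope.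
Variables (k : fieldType) (X : choiceType).
Implicit Types (S T : relators k X) (p q : free_algebra k X).

Lemma to_presentedP S p q :
  to_presented S p = to_presented S q <-> ideal_span S (p - q).
Proof.
split=> [/eqP|Spq].
  by rewrite /to_presented alg_quotP => /asboolP.
by apply/eqP; rewrite /to_presented alg_quotP; apply/asboolP.
Qed.

Lemma to_presented_surj S (u : presented_algebra S) :
  {p | to_presented S p = u}.
Proof. by exists (repr (u : alg_quot (relator_ideal S))); exact: reprK. Qed.

Fact to_presented_zmod S : zmod_morphism (to_presented S).
Proof. by move=> p q; rewrite /to_presented [LHS]raddfB. Qed.

Fact to_presented_monoid S : monoid_morphism (to_presented S).
Proof.
by split=> [|p q]; rewrite /to_presented ?[LHS]rmorph1 ?[LHS]rmorphM.
Qed.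

Fact to_presented_scalable S : scalable (to_presented S).
Proof. by move=> a p; rewrite /to_presented -alg_quot_scaleE. Qed.

HB.instance Definition _ S := GRing.isZmodMorphism.Build
  (free_algebra k X) (presented_algebra S) (to_presented S)
  (to_presented_zmod S).
HB.instance Definition _ S := GRing.isMonoidMorphism.Build
  (free_algebra k X) (presented_algebra S) (to_presented S)
  (to_presented_monoid S).
HB.instance Definition _ S := GRing.isScalable.Build k
  (free_algebra k X) (presented_algebra S) *:%R (to_presented S)
  (to_presented_scalable S).

End PresentedAlgebra.

Section EqualIdeals.
Local Open Scope classical_set_scope.
Local Open Scope ring_scope.
Local Open Scope quotient_scope.
Variables (k : fieldType) (X : choiceType) (S T : relators k X).
Hypothesis sST : ideal_span S `<=` ideal_span T.

(** The inclusion of ideals is an argument so that the morphism structures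
    below, whose proofs depend on it, are inferred from the term. *)
Definition relators_map of ideal_span S `<=` ideal_span T :=
  fun u : presented_algebra S =>
  to_presented T (repr (u : alg_quot (relator_ideal S))).

Local Notation phi := (relators_map sST).

Lemma relators_mapE p : phi (to_presented S p) = to_presented T p.
Proof. by apply/to_presentedP/sST/to_presentedP; exact: reprK. Qed.

Fact relators_map_zmod : zmod_morphism phi.
Proof.
move=> u v; case: (to_presented_surj u) => p <-.
case: (to_presented_surj v) => q <-.
by rewrite -raddfB !relators_mapE raddfB.
Qed.

Fact relators_map_monoid : monoid_morphism phi.
Proof.
split=> [|u v].
  by rewrite -(rmorph1 (to_presented S)) relators_mapE rmorph1.
case: (to_presented_surj u) => p <-; case: (to_presented_surj v) => q <-.
by rewrite -rmorphM !relators_mapE rmorphM.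
Qed.

Fact relators_map_scalable : scalable phi.
Proof.
move=> a u; case: (to_presented_surj u) => p <-.
by rewrite -linearZ !relators_mapE linearZ.
Qed.

HB.instance Definition _ := GRing.isZmodMorphism.Build
  (presented_algebra S) (presented_algebra T) phi relators_map_zmod.
HB.instance Definition _ := GRing.isMonoidMorphism.Build
  (presented_algebra S) (presented_algebra T) phi relators_map_monoid.
HB.instance Definition _ := GRing.isScalable.Build k
  (presented_algebra S) (presented_algebra T) *:%R phi
  relators_map_scalable.

End EqualIdeals.

Lemma same_presentation_eq_ideal (k : fieldType) (X : choiceType)
    (S T : relators k X) :
  ideal_span S = ideal_span T -> same_presentation S T.
Proof.
move=> eqST.
have sST : (ideal_span S `<=` ideal_span T)%classic by rewrite eqST.
have sTS : (ideal_span T `<=` ideal_span S)%classic by rewrite eqST.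
exists (relators_map sST); last by move=> x; exact: relators_mapE.
exists (relators_map sTS) => u; case: (to_presented_surj u) => p <-.
  by rewrite [relators_map _ _]relators_mapE [LHS]relators_mapE.
by rewrite [relators_map _ _]relators_mapE [LHS]relators_mapE.
Qed.

(** * Collapsing a word onto its last letter *)

Section Collapse.
Variables (X : choiceType) (a0 : X).
Implicit Types (s t u v : seq X) (b c d : X).

Definition collapse s :=
  if s is b :: t then rcons (nseq (size t) a0) (last b t) else [::].

Lemma collapse_rcons s c : collapse (rcons s c) = rcons (nseq (size s) a0) c.
Proof. by case: s => [|b s] //=; rewrite size_rcons last_rcons. Qed.

Lemma size_collapse s : size (collapse s) = size s.
Proof. by case: s => [|b s] //=; rewrite size_rcons size_nseq. Qed.

(** The relation b d = c d, placed between u and v, changes neither the length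
    nor the last letter of the word. *)
Lemma collapse_cat2 u b c d v :
  collapse (u ++ [:: b, d & v]) = collapse (u ++ [:: c, d & v]).
Proof.
case/lastP: v => [|v e].
  rewrite -![[:: _; d]]/(rcons [:: _] d) -!rcons_cat.
  by rewrite !collapse_rcons !size_cat.
by rewrite -!rcons_cons -!rcons_cat !collapse_rcons !size_cat.
Qed.

(** In a collapsed word only the last letter can differ from [a0]. *)
Lemma collapse_mid s u b v : collapse s = u ++ b :: v -> b <> a0 -> v = [::].
Proof.
case/lastP: s => [|s c]; first by case: u.
rewrite collapse_rcons; case/lastP: v => [|v d] // + ba0.
rewrite -rcons_cons -rcons_cat => /rcons_inj[+ _] => E.
by have /nseqP[] : b \in nseq (size s) a0 by rewrite E mem_cat mem_head orbT.
Qed.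

Lemma collapse_fixP s :
  collapse s = s <-> forall b c, infix [:: b; c] s -> b = a0.
Proof.
split=> [fix_s b c /infixP[u [v s_eq]]|].
  apply: contrapT => ba0; have := collapse_mid _ ba0 (v := c :: v).
  by move=> /(_ s u); rewrite fix_s => /(_ s_eq).
elim: s => [|b [|c t] IHs] // fix_s.
rewrite (_ : collapse _ = a0 :: collapse (c :: t)) // IHs.
  by rewrite (fix_s b c) // prefixW //= !eqxx prefix0s.
move=> b' c' inf; apply: (fix_s b' c').
exact: infix_trans inf (infix_cons _ _).
Qed.

Lemma collapseK s : collapse (collapse s) = collapse s.
Proof.
by case/lastP: s => // s c; rewrite !collapse_rcons size_nseq.
Qed.

End Collapse.

(** * Normal forms in the free algebra *)

Section NormalForm.
Local Open Scope classical_set_scope.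
Local Open Scope ring_scope.
Variables (k : fieldType) (X : choiceType).
Local Notation F := (free_algebra k X).
Implicit Types (p q : F) (s t u v : seq X).

(** The relations that make a product of two letters independent of the first
    one; a = b is allowed, so 0 is among them. *)
Definition first_letter_relations : set F :=
  [set q | exists a b c : X, q = word k [:: a; c] - word k [:: b; c]].

Lemma wordM s t : word k s * word k t = word k (s ++ t).
Proof.
rewrite /word malgM_def fgmulUU mulr1; congr << _ *g _ >>.
by apply/eqP; rewrite fmP fmM.
Qed.

(** [coeff_scale] and [coeff_word] restate [mcoeffZ] and [mcoeffU1] over
    [free_algebra], where rewriting with the originals has to unfold the
    algebra structure. *)
Lemma coeff_scale (c : k) p (w : {fmonom X}) : (c *: p)@_w = c * p@_w.
Proof. exact: mcoeffZ. Qed.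

Lemma coeff_word s (w : {fmonom X}) : (word k s)@_w = (FMonom s == w)%:R.
Proof. exact: mcoeffU1. Qed.

Lemma free_algebraE p : p = \sum_(w <- msupp p) p@_w *: word k w.
Proof.
rewrite [LHS]monalgE; apply: eq_bigr => w _.
by apply/malgP => v; rewrite coeff_scale coeff_word fmK mcoeffU mulr_natr.
Qed.

Variable a0 : X.

Definition normal_form : F -> F :=
  mmap (@mkmalgU {fmonom X} k mone)
       (fun w : {fmonom X} => word k (collapse a0 w)).

Fact normal_form_zmod : zmod_morphism normal_form.
Proof. exact: mmap_is_additive. Qed.

Fact normal_form_scalable : scalable normal_form.
Proof.
move=> c p; rewrite /normal_form (mmapEw (msuppZ_le _ _)) mmapE scaler_sumr.
apply: eq_bigr => w _.
by rewrite coeff_scale [LHS]mul_malgC [in RHS]mul_malgC scalerA.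
Qed.

HB.instance Definition _ := GRing.isZmodMorphism.Build F F normal_form
  normal_form_zmod.
HB.instance Definition _ := GRing.isScalable.Build k F F *:%R normal_form
  normal_form_scalable.

Lemma normal_form_word s : normal_form (word k s) = word k (collapse a0 s).
Proof. by rewrite /normal_form mmapU mul1r. Qed.

Lemma normal_formE p :
  normal_form p = \sum_(w <- msupp p) p@_w *: word k (collapse a0 w).
Proof.
by rewrite /normal_form mmapE; apply: eq_bigr=> w _; rewrite mul_malgC.
Qed.

(** By induction on s: the relation b c = a0 c replaces the first letter, then
    the rest of the word is collapsed to the right of a0. *)
Lemma ideal_collapse s :
  ideal_span first_letter_relations (word k s - word k (collapse a0 s)).
Proof.
elim: s => [|b [|c t] IHs].
- by rewrite [_ - _]subrr; apply: ideal_span0.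
- by rewrite [_ - _]subrr; apply: ideal_span0.
have -> : word k [:: b, c & t] - word k (collapse a0 [:: b, c & t]) =
    (word k [:: b; c] - word k [:: a0; c]) * word k t +
    word k [:: a0] * (word k (c :: t) - word k (collapse a0 (c :: t))).
  rewrite mulrBl mulrBr (wordM [:: b; c]) (wordM [:: a0; c]).
  by rewrite (wordM [:: a0] (c :: t)) (wordM [:: a0]) [RHS]subrKA.
apply: ideal_spanD; last exact: ideal_spanMl.
by apply/ideal_spanMr/sub_ideal_span; exists b, a0, c.
Qed.

Lemma ideal_normal_form p :
  ideal_span first_letter_relations (p - normal_form p).
Proof.
rewrite {1}[p]free_algebraE normal_formE -sumrB.
apply: (big_ind (ideal_span _)); first exact: ideal_span0.
  exact: ideal_spanD.
move=> w _; rewrite -scalerBr -[_ - _]mul1r scalerAl.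
exact/ideal_spanMl/ideal_collapse.
Qed.

(** An element of the ideal is a combination of products u (a c - b c) v with
    words u and v, each killed by [collapse_cat2]; conversely p is congruent
    to its normal form. *)
Lemma normal_form_ideal p :
  normal_form p = 0 <-> ideal_span first_letter_relations p.
Proof.
split=> [np0|[ts tsE ->]].
  by have := ideal_normal_form p; rewrite np0 subr0.
rewrite raddf_sum big_seq big1 // => -[[p1 g] q1] /tsE /= [a [b [c ->]]].
rewrite [p1]free_algebraE [q1]free_algebraE.
rewrite -mulrA mulr_suml raddf_sum big1 // => u _.
rewrite mulrA mulr_sumr raddf_sum big1 // => v _.
rewrite -scalerAr -!scalerAl scalerA mulrBr mulrBl !wordM /= linearZ raddfB /=.
by rewrite !normal_form_word -!catA (collapse_cat2 _ _ _ b) subrr scaler0.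
Qed.

Lemma normal_form_collapse p w : w \in msupp (normal_form p) ->
  collapse a0 w = w.
Proof.
rewrite -mcoeff_neq0 normal_formE raddf_sum => nz.
apply: contrapT => cw; case/negP: nz; apply/eqP; apply: big1 => v _ /=.
rewrite coeff_scale coeff_word; case: eqP => [w_eq|_]; last exact: mulr0.
by case: cw; rewrite -w_eq /= collapseK.
Qed.

End NormalForm.
Arguments first_letter_relations k X : clear implicits.

(** * The ideal of relations *)

Section FirstLetterIdeal.
Local Open Scope classical_set_scope.
Local Open Scope ring_scope.

(** Both a c and b c equal f(c) c, whatever f is. *)
Lemma yb_idempotent_ideal (k : fieldType) (X : finType) (f : {perm X}) :
  ideal_span (yb_relators k (perm_idempotent f)) =
  ideal_span (first_letter_relations k X).
Proof.
apply: eq_ideal_span => [_ [a [b ->]]|_ [a [b [c ->]]]].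
  by apply/sub_ideal_span; exists a, (f b), b.
have -> : word k [:: a; c] - word k [:: b; c] =
    (word k [:: a; c] - word k [:: f c; c]) -
    (word k [:: b; c] - word k [:: f c; c]).
  by rewrite opprB [RHS]subrKA.
by apply: ideal_spanB; apply: sub_ideal_span; [exists a, c | exists b, c].
Qed.

(** Both a c and b c equal x_1 c; when a or b is x_1 the equality is trivial
    and is not a relator. *)
Lemma frakR_ideal (k : fieldType) (X : choiceType) (n : nat) (x : 'I_n -> X)
    (n_gt0 : (0 < n)%N) : bijective x ->
  ideal_span (frakR k x n_gt0) = ideal_span (first_letter_relations k X).
Proof.
move=> [y _ xK]; set x1 := x (Ordinal n_gt0).
apply: eq_ideal_span => [_ [j [p [_ ->]]]|_ [a [b [c ->]]]].
  by apply/sub_ideal_span; exists (x j), x1, (x p).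
have to_x1 d :
    ideal_span (frakR k x n_gt0) (word k [:: d; c] - word k [:: x1; c]).
  rewrite -(xK d) -(xK c); have [y0|y_gt0] := posnP (y d).
    rewrite (_ : y d = Ordinal n_gt0); last exact: val_inj.
    by rewrite subrr; apply: ideal_span0.
  by apply: sub_ideal_span; exists (y d), (y c).
have -> : word k [:: a; c] - word k [:: b; c] =
    (word k [:: a; c] - word k [:: x1; c]) -
    (word k [:: b; c] - word k [:: x1; c]).
  by rewrite opprB [RHS]subrKA.
exact: ideal_spanB.
Qed.

End FirstLetterIdeal.

(** * The reduced Groebner basis and the basis of normal words *)

Section Groebner.
Local Open Scope classical_set_scope.
Local Open Scope ring_scope.
Variables (k : fieldType) (X : choiceType) (n : nat) (x : 'I_n -> X).
Variable n_gt0 : (0 < n)%N.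
Hypothesis x_bij : bijective x.

Local Notation F := (free_algebra k X).
Local Notation x1 := (x (Ordinal n_gt0)).
Local Notation lt := (deglex (enum_lt x)).
Local Notation I := (ideal_span (first_letter_relations k X)).
Local Notation rel j p := (word k [:: x j; x p] - word k [:: x1; x p]).
Implicit Types (j p : 'I_n) (u v w : {fmonom X}).

Let x_inj : injective x := bij_inj x_bij.

Lemma letterP (b : X) : exists j, x j = b.
Proof. by case: x_bij => y _ xK; exists (y b); exact: xK. Qed.

Lemma x_neq1 j : (0 < j)%N -> x j <> x1.
Proof. by move=> j_gt0 /x_inj j0; rewrite j0 in j_gt0. Qed.

Lemma frakN_fix w : frakN x n_gt0 w <-> collapse x1 w = w.
Proof.
split=> [[->|[m [p ->]]]|] //=.
  by rewrite collapse_rcons size_nseq.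
case: w => s /=; case/lastP: s => [|s c]; first by left.
rewrite collapse_rcons => <-; right; exists (size s).
by have [p <-] := letterP c; exists p.
Qed.

Lemma frakN_redex w :
  frakN x n_gt0 w <-> forall j p, infix [:: x j; x p] w -> j = 0%N :> nat.
Proof.
rewrite frakN_fix collapse_fixP.
split=> [w_fix j p /w_fix /x_inj -> //|w_fix b c].
have [j <-] := letterP b; have [p <-] := letterP c => /w_fix j0.
by congr x; apply: val_inj.
Qed.

(** Since x_1 is the least letter, collapsing never increases a word.  If
    [collapse u] were v, then u and v would have the same length and v would
    have, at the first place where they differ, a letter greater than that of
    u, hence other than x_1.  That place is then the last one, where u and its
    collapse v agree. *)
Lemma deglex_collapse u v : lt u v -> collapse x1 u <> v.
Proof.
move=> [sz_lt|[sz [s [u' [v' [a [b [uE vE [i [j [ij xi xj]]]]]]]]]]] c_uv.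
  by move: sz_lt; rewrite -c_uv size_collapse ltnn.
(* b is x_j with j above the index of a, hence not the first letter. *)
have b_neq : b <> x1 by rewrite -xj; apply: x_neq1; apply: leq_ltn_trans ij.
have v'0 : v' = [::] by apply: (@collapse_mid _ _ u s b) b_neq; rewrite c_uv vE.
have u'0 : u' = [::].
  apply: size0nil; move: sz; rewrite uE vE v'0 !size_cat /= => /addnI.
  by case.
move: c_uv; rewrite uE vE v'0 u'0 !cats1 collapse_rcons => /rcons_inj[_ ab].
by move: ij; rewrite (x_inj (etrans xi (etrans ab (esym xj)))) ltnn.
Qed.

(** If v were in frakN, it would be the only word of q that collapses to v,
    the others being below it: its coefficient would survive in the normal
    form of q, which is 0. *)
Lemma leading_normal (q : F) v :
  I q -> leading_word lt q v -> ~ frakN x n_gt0 v.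
Proof.
move=> /(normal_form_ideal x1) nq0 [v_q v_max] /frakN_fix v_fix.
have := congr1 (mcoeff v) nq0; rewrite normal_formE raddf_sum mcoeff0.
rewrite (big_fsetD1 v) //= big1_fset ?addr0 => [|w].
  rewrite v_fix coeff_scale coeff_word fmK eqxx mulr1 => /eqP.
  by rewrite mcoeff_eq0 v_q.
rewrite !inE => /andP[/eqP w_neq w_q] _; rewrite coeff_scale coeff_word.
case: eqP => [cw|_]; last exact: mulr0.
by case: (v_max w w_q) => // /deglex_collapse; rewrite -cw.
Qed.

Lemma rel_ideal j p : I (rel j p).
Proof. by apply: sub_ideal_span; exists (x j), x1, (x p). Qed.

Section Leading.
Variables j p : 'I_n.
Hypothesis j_gt0 : (0 < j)%N.

Lemma rel_coeff : (rel j p)@_(FMonom [:: x j; x p]) = 1.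
Proof.
rewrite mcoeffB !coeff_word eqxx (_ : (_ == _) = false) ?subr0 //.
by apply/eqP => -[/esym/(x_neq1 j_gt0)].
Qed.

Lemma rel_supp v : v \in msupp (rel j p) ->
  v = FMonom [:: x j; x p] \/ v = FMonom [:: x1; x p].
Proof.
move/(fsubsetP (msuppB_le _ _)); rewrite inE !msuppU1 !inE.
by case/orP => /eqP; [left|right].
Qed.

Lemma rel_neq0 : rel j p != 0.
Proof.
apply/eqP => r0; have := rel_coeff; rewrite r0 mcoeff0 => /esym/eqP.
by rewrite oner_eq0.
Qed.

Lemma rel_lt : lt (FMonom [:: x1; x p]) (FMonom [:: x j; x p]).
Proof.
right; split=> //; exists [::], [:: x p], [:: x p], x1, (x j); split=> //.
by exists (Ordinal n_gt0), j.
Qed.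

Lemma rel_leading : leading_word lt (rel j p) (FMonom [:: x j; x p]).
Proof.
split; first by rewrite -mcoeff_neq0 rel_coeff oner_eq0.
by move=> v /rel_supp[->|->]; [left|right; exact: rel_lt].
Qed.

(** The other word, x_1 x_p, is in frakN, so [leading_normal] excludes it. *)
Lemma rel_leading_uniq v :
  leading_word lt (rel j p) v -> v = FMonom [:: x j; x p].
Proof.
move=> v_lead; case: (v_lead) => /rel_supp[//|v_eq] _.
by case: (leading_normal (rel_ideal j p) v_lead); right; exists 1%N, p.
Qed.

End Leading.

Lemma frakR_groebner : groebner_basis lt I (frakR k x n_gt0).
Proof.
split; first exact: frakR_ideal.
  move=> _ [j [p [j_gt0 ->]]]; exists (FMonom [:: x j; x p]).
    exact: rel_leading.
  exact: rel_coeff.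
move=> q v Iq _ v_lead; apply: contrapT => no_red.
apply: (leading_normal Iq v_lead); apply/frakN_redex => j p jp_v.
have [//|j_gt0] := posnP j; case: no_red.
exists (rel j p), (FMonom [:: x j; x p]).
by split=> //; [exists j, p | apply: rel_leading].
Qed.

Lemma infix2 (a b c d : X) : infix [:: a; b] [:: c; d] -> (a = c) * (b = d).
Proof. by rewrite /= !andbF !orbF andbT => /andP[/eqP-> /eqP->]. Qed.

(** Leading words of relators have length 2, so one is a factor of another
    only if they are equal, and then so are the relators.  The other word
    x_1 x_p of a relator is no leading word, as its first letter is x_1. *)
Lemma frakR_reduced : reduced_groebner_basis lt I (frakR k x n_gt0).
Proof.
split; first exact: frakR_groebner.
  move=> _ [j [p [j_gt0 ->]]] [_ _ G].
  have [_ [u [[[j' [p' [j'_gt0 ->]]] g_neq]]]] :=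
    G _ _ (rel_ideal j p) (rel_neq0 p j_gt0) (rel_leading p j_gt0).
  move=> /rel_leading_uniq -> /infix2[/x_inj jj /x_inj pp].
  by apply: g_neq; rewrite jj pp.
move=> _ w [j [p [j_gt0 ->]]] w_supp _ v [[j' [p' [j'_gt0 ->]]] g_neq] _.
move=> /rel_leading_uniq ->; apply/negP.
case: (rel_supp w_supp) => -> /infix2[jj /x_inj pp].
  by apply: g_neq; rewrite (x_inj jj) pp.
by case: (x_neq1 j'_gt0).
Qed.

Lemma normal_words_ideal : normal_words lt I = frakN x n_gt0.
Proof.
apply/seteqP; split=> w /= w_nf.
  apply/frakN_redex => j p jp_w; have [//|j_gt0] := posnP j.
  have := w_nf _ _ (rel_ideal j p) (rel_neq0 p j_gt0) (rel_leading p j_gt0).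
  by rewrite jp_w.
move=> q v Iq _ v_lead; apply/negP => v_w.
apply: (leading_normal Iq v_lead); apply/frakN_redex => j p jp_v.
by move/frakN_redex: w_nf => /(_ j p); apply; apply: infix_trans v_w.
Qed.

Lemma frakR_finite : finite_set (frakR k x n_gt0 : set F).
Proof.
apply: (@sub_finite_set _ _ [set rel jp.1 jp.2 | jp in [set: 'I_n * 'I_n]]).
  by move=> _ [j [p [_ ->]]]; exists (j, p).
exact/finite_image/finite_finset.
Qed.

Lemma normal_words_basis (S : relators k X) : ideal_span S = I ->
  is_basis (frakN x n_gt0)
    (fun w : {fmonom X} => to_presented S (word k w) : presented_algebra S).
Proof.
move=> SI; split=> [s c s_uniq s_nf|u].
  have -> : \sum_(w <- s) c w *: to_presented S (word k w) =
      to_presented S (\sum_(w <- s) c w *: word k w).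
    by rewrite linear_sum; apply: eq_bigr => w _; rewrite linearZ.
  rewrite -(raddf0 (to_presented S)) => /to_presentedP.
  rewrite subr0 SI => /(normal_form_ideal x1); rewrite linear_sum => nf0 w w_s.
  have sum0 : \sum_(v <- s) c v *: word k v = 0.
    rewrite -[RHS]nf0; apply: eq_big_seq => v /s_nf/frakN_fix v_fix.
    by rewrite linearZ /= normal_form_word v_fix.
  have := congr1 (mcoeff w) sum0; rewrite raddf_sum mcoeff0.
  rewrite (eq_bigr (fun v => c v * (v == w)%:R)) => [|v _]; last first.
    by rewrite /= coeff_scale coeff_word fmK.
  rewrite (bigD1_seq w) //= eqxx mulr1 big1 ?addr0 // => v /negPf->.
  exact: mulr0.
have [q <-] := to_presented_surj u; set q' := normal_form x1 q.
exists (msupp q'), (fun w => q'@_w); split.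
  by move=> w /normal_form_collapse w_fix; apply/frakN_fix.
transitivity (to_presented S q').
  by apply/to_presentedP; rewrite SI; apply: ideal_normal_form.
rewrite {1}[q']free_algebraE linear_sum.
by apply: eq_bigr => w _; rewrite linearZ.
Qed.

End Groebner.

Theorem corollary3p5 (k : fieldType) (X : finType) (n : nat) (n_ge2 : 1 < n)
    (cardX : #|X| = n) (f g : {perm X}) :
  alg_isomorphic (yb_algebra k (perm_idempotent f))
                 (yb_algebra k (perm_idempotent g)) /\
  forall x : 'I_n -> X, bijective x ->
  forall h : {perm X}, h = f \/ h = g ->
    let lt := deglex (enum_lt x) in
    let S := yb_relators k (perm_idempotent h) in
    [/\ standard_finite_presentation lt S (frakR k x (ltnW n_ge2)),
        normal_words lt (ideal_span S) = frakN x (ltnW n_ge2)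
      & is_basis (frakN x (ltnW n_ge2))
          (fun w : {fmonom X} =>
             to_presented S (word k w) : yb_algebra k (perm_idempotent h))].
Proof.
split.
  have [phi phi_bij _] : same_presentation (yb_relators k (perm_idempotent f))
                                           (yb_relators k (perm_idempotent g)).
    apply: same_presentation_eq_ideal.
    exact: etrans (yb_idempotent_ideal k f) (esym (yb_idempotent_ideal k g)).
  by exists phi.
move=> x x_bij h _ lt S; have S_ideal := yb_idempotent_ideal k h.
have R_ideal := frakR_ideal k (ltnW n_ge2) x_bij.
split; last exact: normal_words_basis.
  split; first by apply: same_presentation_eq_ideal; rewrite S_ideal R_ideal.
    exact: frakR_finite.
  by rewrite S_ideal; apply: frakR_reduced.
by rewrite S_ideal; apply: normal_words_ideal.
Qed.
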